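(* Let $(\mathbb D,d)$ be a semimetric space and let $(\mathbb E,e)$ be a metric space. Let $g:\mathbb D\to\mathbb E$ be arbitrary and let $D_g$ be the set of $x\in\mathbb D$ such that $g$ is not continuous in $x$. Let $(\Omega_\alpha,\mathcal A_\alpha,P_\alpha)$, $\alpha\in A$, be a net of probability spaces and let $X_\alpha:\Omega_\alpha\to\mathbb D$ be arbitrary maps; let $(\Omega,\mathcal A,P)$ be a probability space and let $X:\Omega\to\mathbb D$ be Borel measurable. If $[X_\alpha]\rightsquigarrow[X]$ in $[\mathbb D]$ and if $X(\Omega)\subset\mathbb D\setminus D_g$, then $g(X):\Omega\to\mathbb E$ is Borel measurable and $g(X_\alpha)\rightsquigarrow g(X)$ in $\mathbb E$.
   Context: A semimetric satisfies all axioms of a metric except that $d(x,y)=0$ need not imply $x=y$. For $x\in\mathbb D$, $[x]=\{y\in\mathbb D:d(x,y)=0\}$, and $[\mathbb D]=\{[x]:x\in\mathbb D\}$ is a metric space with $d([x],[y])=d(x,y)$. Borel $\sigma$-fields are generated by the open sets of the (semi)metric topology. $[X]$ is the composition of $X$ with $x\mapsto[x]$. Weak convergence of nets is in the Hoffmann-Jørgensen sense: for arbitrary maps $Y_\alpha$ into a metric space and Borel measurable $Y$, $Y_\alpha\rightsquigarrow Y$ means $E^*[h(Y_\alpha)]\to E[h(Y)]$ for every bounded continuous real function $h$, where $E^*$ is outer expectation. *)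

(* Defs.v *)
From HB Require Import structures.
From mathcomp Require Import all_boot all_order all_algebra.
From mathcomp Require Import all_classical all_reals all_analysis measurable_realfun.

Set Implicit Arguments.
Unset Strict Implicit.
Unset Printing Implicit Defensive.

Import Order.TTheory GRing.Theory Num.Def Num.Theory.
Import numFieldNormedType.Exports.

Local Open Scope classical_set_scope.
Local Open Scope ring_scope.

(* Semimetric spaces: the analogue of [metricType] without the axiom that
   points at distance 0 are equal. The balls, hence the topology, are those of
   the semimetric. *)
HB.mixin Record PseudoMetric_isSemimetric (K : numDomainType) M
    & PseudoMetric K M := {
  sdist : M -> M -> K ;
  sdistxx : forall x, sdist x x = 0 ;
  sdist_sym : forall x y, sdist x y = sdist y x ;
  sdist_triangle : forall y x z, sdist x z <= sdist x y + sdist y z ;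
  ballEsdist : forall x r, ball x r = [set y | sdist x y < r]
}.

#[short(type="semimetricType")]
HB.structure Definition Semimetric (K : numDomainType) :=
  { M of PseudoMetric K M & PseudoMetric_isSemimetric K M }.

(* Any function satisfying the semimetric axioms makes its carrier a
   [semimetricType]. *)
HB.factory Record isSemimetric (K : numFieldType) (M : Type) & Choice M := {
  sdist : M -> M -> K ;
  sdistxx : forall x, sdist x x = 0 ;
  sdist_sym : forall x y, sdist x y = sdist y x ;
  sdist_triangle : forall y x z, sdist x z <= sdist x y + sdist y z
}.

HB.builders Context K M & isSemimetric K M.

Let ball (x : M) r : set M := [set y | sdist x y < r].

Let ent : set_system (M * M) := entourage_ ball.

Let nbhs (x : M) : set_system M := nbhs_ ent x.

Let nbhsE : nbhs = nbhs_ ent. Proof. by []. Qed.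

HB.instance Definition _ := hasNbhs.Build M nbhs.

Let ball_center x (r : K) : 0 < r -> ball x r x.
Proof. by move=> r0; rewrite /ball/= sdistxx. Qed.

Let ball_sym x y (r : K) : ball x r y -> ball y r x.
Proof. by rewrite /ball/= sdist_sym. Qed.

Let ball_triangle x y z r1 r2 : ball x r1 y -> ball y r2 z ->
  ball x (r1 + r2) z.
Proof.
by rewrite /ball/= => ? ?; rewrite (le_lt_trans (sdist_triangle y _ _))// ltrD.
Qed.

Let entourageE : ent = entourage_ ball. Proof. by []. Qed.

HB.instance Definition _ := @Nbhs_isPseudoMetric.Build K M
  ent nbhsE ball ball_center ball_sym ball_triangle entourageE.

Let ballEsdist x r : ball x r = [set y | sdist x y < r]. Proof. by []. Qed.

HB.instance Definition _ := PseudoMetric_isSemimetric.Build K M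
  sdistxx sdist_sym sdist_triangle ballEsdist.

HB.end.

Lemma sdist_ge0 (K : numDomainType) (D : semimetricType K) (x y : D) :
  0 <= sdist x y.
Proof.
rewrite -(@pmulrn_lge0 _ _ 2)// -(sdistxx x).
by rewrite (le_trans (sdist_triangle y _ _))// [sdist y x]sdist_sym -mulr2n.
Qed.

Section metric_quotient.
Context {K : numFieldType} (D : semimetricType K).

Definition zero_class (x : D) : set D := [set y | sdist x y = 0].

Definition metric_quotient : Type := range zero_class.

HB.instance Definition _ := gen_eqMixin metric_quotient.
HB.instance Definition _ := gen_choiceMixin metric_quotient.

Definition to_quotient (x : D) : metric_quotient :=
  exist (fun c => c \in range zero_class) (zero_class x)
    (mem_set (imageT zero_class x)).

Lemma to_quotient_surj (c : metric_quotient) : exists x, to_quotient x = c.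
Proof.
case: c => c ic; have [x _ xc] := set_mem ic.
by exists x; apply: eq_exist.
Qed.

Lemma to_quotientP (x y : D) :
  to_quotient x = to_quotient y <-> sdist x y = 0.
Proof.
split=> [/(congr1 (@proj1_sig _ _))/= xy|xy].
  have : zero_class y y by exact: sdistxx.
  by rewrite -xy.
apply: eq_exist; apply/seteqP; split => z /= xz.
- apply/eqP; rewrite eq_le sdist_ge0 andbT.
  by rewrite (le_trans (sdist_triangle x _ _))// sdist_sym xy xz addr0.
- apply/eqP; rewrite eq_le sdist_ge0 andbT.
  by rewrite (le_trans (sdist_triangle y _ _))// xy xz addr0.
Qed.

Definition quotient_repr (c : metric_quotient) : D :=
  proj1_sig (cid (to_quotient_surj c)).

Lemma quotient_reprK (c : metric_quotient) : to_quotient (quotient_repr c) = c.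
Proof. by rewrite /quotient_repr; case: cid. Qed.

Definition quotient_dist (c c' : metric_quotient) : K :=
  sdist (quotient_repr c) (quotient_repr c').

Lemma quotient_distE (x y : D) :
  quotient_dist (to_quotient x) (to_quotient y) = sdist x y.
Proof.
rewrite /quotient_dist.
set x' := quotient_repr _; set y' := quotient_repr _.
have x0 : sdist x' x = 0 by apply/to_quotientP; exact: quotient_reprK.
have y0 : sdist y' y = 0 by apply/to_quotientP; exact: quotient_reprK.
apply/eqP; rewrite eq_le; apply/andP; split.
- rewrite (le_trans (sdist_triangle x _ _))// x0 add0r.
  by rewrite (le_trans (sdist_triangle y _ _))// [sdist y _]sdist_sym y0 addr0.
- rewrite (le_trans (sdist_triangle x' _ _))// [sdist x x']sdist_sym x0 add0r.
  by rewrite (le_trans (sdist_triangle y' _ _))// y0 addr0.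
Qed.

Let quotient_distxx c : quotient_dist c c = 0.
Proof. exact: sdistxx. Qed.

Let quotient_dist_positivity c c' : quotient_dist c c' = 0 -> c = c'.
Proof.
by move=> /to_quotientP; rewrite !quotient_reprK.
Qed.

Let quotient_dist_sym c c' : quotient_dist c c' = quotient_dist c' c.
Proof. exact: sdist_sym. Qed.

Let quotient_dist_triangle c' c c'' :
  quotient_dist c c'' <= quotient_dist c c' + quotient_dist c' c''.
Proof. exact: sdist_triangle. Qed.

HB.instance Definition _ := isMetric.Build K metric_quotient
  quotient_distxx quotient_dist_positivity quotient_dist_sym
  quotient_dist_triangle.

Lemma mdist_to_quotient (x y : D) :
  mdist (to_quotient x) (to_quotient y) = sdist x y.
Proof. exact: quotient_distE. Qed.

End metric_quotient.

(* This is [measurable_fun setT X] for the Borel sigma-algebra on [T], stated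
   without the base point that [measurableType] would require of [T]. *)
Definition borel_measurable d (Omega : measurableType d) (T : topologicalType)
    (X : Omega -> T) : Prop :=
  forall B : set T, <<s open >> B -> measurable (X @^-1` B).

Definition discontinuity_set (S T : topologicalType) (g : S -> T) : set S :=
  [set x | ~ {for x, continuous g}].

(* The integral of [U] is admitted only if it exists, i.e., if the positive and
   negative parts do not both have infinite integral; otherwise [\int] is a junk
   value. *)
Definition outer_expectation d (Omega : measurableType d) (R : realType)
    (P : probability Omega R) (f : Omega -> \bar R) : \bar R :=
  ereal_inf [set (\int[P]_w U w)%E | U in [set U : Omega -> \bar R |
    [/\ measurable_fun setT U,
        ((\int[P]_w U^\+ w) +? (- \int[P]_w U^\- w))%E
      & forall w, (f w <= U w)%E]]].

Definition directed disp (A : preorderType disp) : Prop :=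
  inhabited A /\ forall a b : A, exists c : A, (a <= c)%O /\ (b <= c)%O.

Definition net_filter disp (A : preorderType disp) : set_system A :=
  filter_from setT (fun a : A => [set b : A | (a <= b)%O]).

Arguments net_filter {disp} A.

Lemma net_filter_proper disp (A : preorderType disp) :
  directed A -> ProperFilter (net_filter A).
Proof.
move=> [[a0] dirA]; apply: filter_from_proper; last first.
  by move=> a _; exists a => /=.
apply: filter_from_filter; first by exists a0.
move=> a b _ _; have [c [ac bc]] := dirA a b.
by exists c => // x /= cx; split; apply: le_trans cx.
Qed.

(* Hoffmann-Joergensen weak convergence of the net of arbitrary maps [Y_] to
   [Y], which is meant to be Borel measurable. *)
Definition weak_cvg (R : realType) (S : metricType R)
    disp (A : preorderType disp)
    (d_ : A -> measure_display) (Omega_ : forall a, measurableType (d_ a))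
    (P_ : forall a, probability (Omega_ a) R) (Y_ : forall a, Omega_ a -> S)
    d (Omega : measurableType d) (P : probability Omega R) (Y : Omega -> S) :
    Prop :=
  forall h : S -> R, continuous h -> bounded_fun h ->
    outer_expectation (P_ a) (fun w => (h (Y_ a w))%:E) @[a --> net_filter A]
      --> 'E_P[h \o Y]%E.

(* Main.v *)
(* For a bounded f : D -> R continuous at every point of the range of X, the
   n-Lipschitz envelope F_n(x) = sup_y (f y - n d(x, y)) is a bounded Lipschitz
   majorant of f that factors through the quotient and tends to f at every
   continuity point of f. Hence limsup E^* f(X_a) <= lim E^* F_n(X_a) = E F_n(X)
   for each n, and E F_n(X) -> E f(X) by dominated convergence. The Lipschitz
   minorants obtained from the envelopes of -f bound the liminf in the same way.
   One takes f = h o g with h bounded and continuous. *)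
Require Import Defs.
From HB Require Import structures.
From mathcomp Require Import all_boot all_order all_algebra.
From mathcomp Require Import all_classical all_reals all_analysis measurable_realfun.
From mathcomp Require Import lra.

Set Implicit Arguments.
Unset Strict Implicit.
Unset Printing Implicit Defensive.

Import Order.TTheory GRing.Theory Num.Theory.
Import numFieldNormedType.Exports.

Local Open Scope classical_set_scope.
Local Open Scope ring_scope.

(** * Measurability, outer expectation and limit criteria *)

Lemma borel_measurable_comp d (Omega : measurableType d)
    (S T : topologicalType) (X : Omega -> S) (g : S -> T) :
  borel_measurable X -> (forall w, {for X w, continuous g}) ->
  borel_measurable (g \o X).
Proof.
move=> mX cg; rewrite /borel_measurable.
suff : <<s open >> `<=` [set B : set T | measurable ((g \o X) @^-1` B)] by [].
apply: smallest_sub; first split => [|B /= mB|B_ /= mB].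
- by rewrite /= preimage_set0.
- by rewrite setTD preimage_setC; exact: measurableC.
- by rewrite preimage_bigcup; exact: bigcup_measurable.
- move=> B oB /=.
  (* The preimage of [B] under [g] need not be open. Since [g] is continuous at each [X w], every
     [X w] in that preimage lies in its interior, so both sets pull back to the same event. *)
  rewrite (_ : _ @^-1` B = X @^-1` (g @^-1` B)°); last first.
    apply/seteqP; split => w /= Bw; last exact: interior_subset Bw.
    by apply: cg; exact: open_nbhs_nbhs.
  by apply: mX; apply: sub_sigma_algebra; exact: open_interior.
Qed.

Lemma borel_measurable_measurable_fun d (Omega : measurableType d)
    (R : realType) (X : Omega -> R) :
  borel_measurable X -> measurable_fun setT X.
Proof.
move=> mX; apply: (measurability _ (RGenOpens.measurableE R)).
move=> _ [_ [a [b ->]] <-]; rewrite setTI.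
by apply: mX; apply: sub_sigma_algebra; exact: interval_open.
Qed.

Lemma outer_expectation_le d (Omega : measurableType d) (R : realType)
    (P : probability Omega R) (f1 f2 : Omega -> \bar R) :
  (forall w, f1 w <= f2 w)%E ->
  (outer_expectation P f1 <= outer_expectation P f2)%E.
Proof.
move=> f12; apply: le_ereal_inf => _ [U [mU intU f2U] <-].
by exists U => //; split=> // w; exact: le_trans (f12 w) (f2U w).
Qed.

(** The constant [M] is integrable for a probability and serves as the dominating function.
    Finiteness of the limit is recorded so that it can later be treated as a real number. *)
Lemma bounded_convergence d (Omega : measurableType d) (R : realType)
    (P : probability Omega R) (M : R) (f_ : (Omega -> R)^nat) (f : Omega -> R) :
  (forall n, measurable_fun setT (f_ n)) -> measurable_fun setT f ->
  (forall n w, `|f_ n w| <= M) -> (forall w, f_ ^~ w @ \oo --> f w) ->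
  'E_P[f]%E \is a fin_num /\ ('E_P[f_ n] @[n --> \oo] --> 'E_P[f])%E.
Proof.
move=> mf_ mf fM f_f.
have [||||| intf _ cvgf] := @dominated_convergence _ _ _ P setT measurableT
  (fun n w => (f_ n w)%:E) (EFin \o f) (EFin \o cst M).
- by move=> n; exact/measurable_EFinP.
- exact/measurable_EFinP.
- by apply: aeW => w _; apply: cvg_EFin; [exact: nearW|exact: f_f].
- exact: finite_measure_integrable_cst.
- by apply: aeW => w n _ /=; rewrite lee_fin.
split; first by rewrite unlock; exact: integrable_fin_num.
by move: cvgf; rewrite unlock.
Qed.

Lemma cvge_squeeze_eps (R : realType) (I : Type) (F : set_system I)
    {FF : Filter F} (u : I -> \bar R) (r : R) :
  (forall e, 0 < e -> \near F, ((r - e)%:E <= u F <= (r + e)%:E)%E) ->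
  u @ F --> r%:E.
Proof.
move=> ur; apply: cvg_EFin.
  (* The bounds for the arbitrary choice [e = 1] already force [u i] to be finite eventually. *)
  near=> i; have : ((r - 1)%:E <= u i <= (r + 1)%:E)%E by near: i; exact: ur.
  by case: (u i) => // /andP[].
apply/cvgrPdist_le => e e0; near=> i => /=.
have : ((r - e)%:E <= u i <= (r + e)%:E)%E by near: i; exact: ur.
case: (u i) => [s| |] /andP[] //=.
by rewrite !lee_fin distrC ler_distl => -> ->.
Unshelve. all: by end_near. Qed.

Lemma continuous_le_mdist (R : realType) (T : metricType R) (f : T -> R)
    (k : R) : 0 <= k -> (forall x y, f x <= f y + k * mdist x y) ->
  continuous f.
Proof.
move=> k0 fk x; apply/cvgrPdist_le => e e0.
(* The radius [e / (k + 1)] also makes sense when [k = 0]. *)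
have k1 : 0 < k + 1 by rewrite ltr_wpDl.
near=> y.
have xy : k * mdist x y <= e.
  have : ball x (e / (k + 1)) y.
    by near: y; apply: nbhsx_ballx; rewrite divr_gt0.
  rewrite ballEmdist /= ltr_pdivlMr// mulrC => /ltW; apply: le_trans.
  by rewrite ler_wpM2r ?mdist_ge0// lerDl.
rewrite ler_distl; apply/andP; split.
  by rewrite lerBlDr (le_trans (fk y x))// lerD2l metric_sym.
by rewrite (le_trans (fk x y))// lerD2l.
Unshelve. all: by end_near. Qed.

(** * Lipschitz envelopes on the metric quotient *)

Section upper_lipschitz_envelope.
Context (R : realType) (D : semimetricType R).
Implicit Types (f : D -> R) (c : metric_quotient D).

(* On the quotient, the least [k]-Lipschitz function dominating [f], which need
   not itself descend to the quotient. *)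
Definition upper_envelope f (k : R) c : R :=
  sup [set f y - k * mdist c (to_quotient y) | y in [set: D]].

Variables (f : D -> R) (M : R).
Hypothesis fM : forall x, `|f x| <= M.

Let fleM x : f x <= M. Proof. exact: le_trans (ler_norm _) (fM x). Qed.

Let envelope_nonempty k c :
  [set f y - k * mdist c (to_quotient y) | y in [set: D]] !=set0.
Proof.
have [x _] := to_quotient_surj c.
by exists (f x - k * mdist c (to_quotient x)), x.
Qed.

Let envelope_has_sup k c : 0 <= k ->
  has_sup [set f y - k * mdist c (to_quotient y) | y in [set: D]].
Proof.
move=> k0; split; first exact: envelope_nonempty.
exists M => _ [y _ <-]; rewrite (le_trans _ (fleM y))// gerBl mulr_ge0//.
exact: mdist_ge0.
Qed.

Lemma upper_envelope_ge k x : 0 <= k ->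
  f x <= upper_envelope f k (to_quotient x).
Proof.
move=> k0; apply: ub_le_sup; first by case: (envelope_has_sup (to_quotient x) k0).
by exists x => //; rewrite mdistxx mulr0 subr0.
Qed.

Lemma norm_upper_envelope_le k c : 0 <= k -> `|upper_envelope f k c| <= M.
Proof.
move=> k0; rewrite ler_norml; apply/andP; split.
  have [x <-] := to_quotient_surj c.
  rewrite (le_trans _ (upper_envelope_ge x k0))//.
  by have := fM x; rewrite ler_norml => /andP[].
apply: ge_sup; first exact: envelope_nonempty.
move=> _ [y _ <-]; rewrite (le_trans _ (fleM y))// gerBl mulr_ge0//.
exact: mdist_ge0.
Qed.

(** By the triangle inequality, each function under the supremum is [k]-Lipschitz in [c] with the
    same constant, and a supremum inherits such a bound. *)
Lemma upper_envelope_lipschitz k c c' : 0 <= k ->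
  upper_envelope f k c <= upper_envelope f k c' + k * mdist c c'.
Proof.
move=> k0; apply: ge_sup; first exact: envelope_nonempty.
move=> _ [y _ <-]; rewrite -lerBlDr.
apply: (@le_trans _ _ (f y - k * mdist c' (to_quotient y))); last first.
  by apply: ub_le_sup; [case: (envelope_has_sup c' k0)|exists y].
rewrite -addrA -opprD lerD2l lerN2 -mulrDr ler_wpM2l//.
by rewrite addrC [mdist c c']metric_sym; exact: metric_triangle.
Qed.

Lemma continuous_upper_envelope k : 0 <= k -> continuous (upper_envelope f k).
Proof.
move=> k0; apply: (continuous_le_mdist k0) => c c'.
exact: upper_envelope_lipschitz.
Qed.

Lemma upper_envelope_cvg x : {for x, continuous f} ->
  upper_envelope f n%:R (to_quotient x) @[n --> \oo] --> f x.
Proof.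
move=> /cvgrPdist_le cf; apply/cvgrPdist_le => e e0.
have /nbhs_ballP[r /= r0 xr] := cf _ e0.
near=> n.
rewrite ler_distlC; apply/andP; split.
  rewrite (le_trans _ (upper_envelope_ge x _))//.
  by rewrite gerBl ltW.
apply: ge_sup; first exact: envelope_nonempty.
move=> _ [y _ <-]; rewrite mdist_to_quotient.
(* Near [x], continuity bounds [f y] by [f x + e]. Far from [x], the penalty is at least [n%:R * r],
   which eventually exceeds the largest possible gap [2 * M] between two values of [f]. *)
have [xy|rxy] := ltP (sdist x y) r.
  have /xr : ball x r y by rewrite ballEsdist.
  rewrite /= ler_distlC => /andP[_]; apply: le_trans.
  by rewrite gerBl mulr_ge0// sdist_ge0.
have nr : 2 * M <= n%:R * r.
  rewrite -ler_pdivrMr//; near: n; exact: nbhs_infty_ger.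
have : n%:R * r <= n%:R * sdist x y by rewrite ler_wpM2l.
have /lerNnormlW Mx := fM x; have yM := fleM y; lra.
Unshelve. all: by end_near. Qed.

End upper_lipschitz_envelope.

(** The quotient map preserves distances, so the same radius works on both sides. *)
Lemma continuous_to_quotient (R : realType) (D : semimetricType R) :
  continuous (@to_quotient R D).
Proof.
move=> x B /nbhs_ballP[r /= r0 rB]; apply/nbhs_ballP; exists r => //= y.
rewrite ballEsdist /= => xy; apply: rB.
by rewrite ballEmdist /= mdist_to_quotient.
Qed.

(** * Passage to the limit along the net *)

Section semimetric_weak_convergence.
Context (R : realType) (D : semimetricType R).
Context (disp : Order.disp_t) (A : preorderType disp).
Context (d_ : A -> measure_display) (Omega_ : forall a : A, measurableType (d_ a)).
Variables (P_ : forall a : A, probability (Omega_ a) R).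
Variables (X_ : forall a : A, Omega_ a -> D).
Context (d : measure_display) (Omega : measurableType d).
Variables (P : probability Omega R) (X : Omega -> D).
Hypothesis dirA : directed A.
Hypothesis mX : borel_measurable X.
Hypothesis X_X : weak_cvg P_ (fun a w => to_quotient (@X_ a w)) P
  (fun w => to_quotient (X w)).

(** Serves both the majorants and the minorants. The limit [f] need not descend to the quotient;
    [f \o X] is measurable because [f] is continuous along [X]. *)
Let expectation_quotient_cvg (F_ : (metric_quotient D -> R)^nat) (f : D -> R)
    (M : R) :
    (forall n, continuous (F_ n)) -> (forall n c, `|F_ n c| <= M) ->
    (forall w, {for X w, continuous f}) ->
    (forall w, F_ n (to_quotient (X w)) @[n --> \oo] --> f (X w)) ->
  'E_P[f \o X]%E \is a fin_num /\
  ('E_P[fun w => F_ n (to_quotient (X w))] @[n --> \oo] --> 'E_P[f \o X])%E.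
Proof.
move=> cF FM cf Ff; apply: (@bounded_convergence _ _ _ P M) => //.
- move=> n; apply: borel_measurable_measurable_fun.
  apply: (borel_measurable_comp (g := F_ n \o @to_quotient R D)) => // w.
  by apply: continuous_comp; [exact: continuous_to_quotient|exact: cF].
- exact/borel_measurable_measurable_fun/borel_measurable_comp.
Qed.

Lemma outer_expectation_cvg (f : D -> R) (M : R) :
    (forall x, `|f x| <= M) -> (forall w, {for X w, continuous f}) ->
  (outer_expectation (P_ a) (fun w => (f (@X_ a w))%:E) @[a --> net_filter A]
    --> 'E_P[f \o X])%E.
Proof.
move=> fM cf.
have NfM x : `|(\- f) x| <= M by rewrite normrN.
pose F_ n := upper_envelope f n%:R.
pose G_ n := \- upper_envelope (\- f) n%:R.
have bF n c : `|F_ n c| <= M by exact: norm_upper_envelope_le.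
have bG n c : `|G_ n c| <= M by rewrite normrN; exact: norm_upper_envelope_le.
have cF n : continuous (F_ n) by exact: (continuous_upper_envelope fM).
have cG n : continuous (G_ n).
  by move=> c; apply: continuousN; exact: (continuous_upper_envelope NfM).
have [fin_f cvgF] := expectation_quotient_cvg cF bF cf
  (fun w => upper_envelope_cvg fM (cf w)).
have Gf w : G_ n (to_quotient (X w)) @[n --> \oo] --> f (X w).
  rewrite -[f _]opprK; apply: cvgN; apply: (upper_envelope_cvg NfM).
  by apply: continuousN; exact: cf.
have [_ cvgG] := expectation_quotient_cvg cG bG cf Gf.
have bounded_ (h : metric_quotient D -> R) :
    (forall c, `|h c| <= M) -> bounded_fun h.
  move=> hM; exists M; split; first exact: num_real.
  by move=> N MN c _; exact: le_trans (hM c) (ltW MN).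
move: cvgF cvgG; rewrite -(fineK fin_f); set r := fine _ => cvgF cvgG.
have netA := net_filter_proper dirA.
apply: cvge_squeeze_eps => e e0.
(* The indices [n] and [m] are fixed before the net index moves. Weak convergence is then applied to
   just two bounded continuous functions, so dominated convergence is used only along sequences. *)
have [n Fn] : exists n, ('E_P[fun w => F_ n (to_quotient (X w))] < (r + e)%:E)%E.
  apply: (@filter_ex _ \oo%classic); apply: (cvgF [set y | (y < (r + e)%:E)%E]).
  apply: open_nbhs_nbhs; split; first exact: open_ereal_lt_ereal.
  by rewrite /= lte_fin ltrDl.
have [m Gm] : exists m, ((r - e)%:E < 'E_P[fun w => G_ m (to_quotient (X w))])%E.
  apply: (@filter_ex _ \oo%classic); apply: (cvgG [set y | ((r - e)%:E < y)%E]).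
  apply: open_nbhs_nbhs; split; first exact: open_ereal_gt_ereal.
  by rewrite /= lte_fin gtrBl.
have nearG := X_X (cG m) (bounded_ _ (bG m)).
have {}nearG : \forall a \near net_filter A, ((r - e)%:E <
    outer_expectation (P_ a) (fun w => (G_ m (to_quotient (@X_ a w)))%:E))%E.
  apply: (nearG [set y | ((r - e)%:E < y)%E]).
  by apply: open_nbhs_nbhs; split => //; exact: open_ereal_gt_ereal.
have nearF := X_X (cF n) (bounded_ _ (bF n)).
have {}nearF : \forall a \near net_filter A, (
    outer_expectation (P_ a) (fun w => (F_ n (to_quotient (@X_ a w)))%:E) <
    (r + e)%:E)%E.
  apply: (nearF [set y | (y < (r + e)%:E)%E]).
  by apply: open_nbhs_nbhs; split => //; exact: open_ereal_lt_ereal.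
(* The maps [X_ a] are arbitrary, so the comparison with [G_ m] and [F_ n] rests on monotonicity of
   outer expectation alone. *)
near=> a; apply/andP; split.
- apply: (@le_trans _ _ (outer_expectation (P_ a)
    (fun w => (G_ m (to_quotient (@X_ a w)))%:E))).
    by apply: ltW; near: a.
  apply: outer_expectation_le => w; rewrite lee_fin.
  by rewrite -[leRHS]opprK lerN2; exact: (upper_envelope_ge NfM).
- apply: (@le_trans _ _ (outer_expectation (P_ a)
    (fun w => (F_ n (to_quotient (@X_ a w)))%:E))).
    apply: outer_expectation_le => w; rewrite lee_fin.
    exact: (upper_envelope_ge fM).
  by apply: ltW; near: a.
Unshelve. all: by end_near. Qed.

End semimetric_weak_convergence.

Theorem theorem8p2 (R : realType) (D : semimetricType R) (E : metricType R)
    (g : D -> E)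
    (disp : Order.disp_t) (A : preorderType disp) (dirA : directed A)
    (d_ : A -> measure_display) (Omega_ : forall a : A, measurableType (d_ a))
    (P_ : forall a : A, probability (Omega_ a) R)
    (X_ : forall a : A, Omega_ a -> D)
    (d : measure_display) (Omega : measurableType d) (P : probability Omega R)
    (X : Omega -> D) (mX : borel_measurable X) :
  weak_cvg P_ (fun a w => to_quotient (X_ a w)) P (fun w => to_quotient (X w)) ->
  range X `<=` [set: D] `\` discontinuity_set g ->
  borel_measurable (g \o X) /\
  weak_cvg P_ (fun a => g \o X_ a) P (g \o X).
Proof.
move=> X_X XDg.
have cg w : {for X w, continuous g}.
  have [_ /contrapT //] : ([set: D] `\` discontinuity_set g) (X w).
  by apply: XDg; exists w.
split; first exact: borel_measurable_comp.
move=> h ch /pinfty_ex_gt0[M _ hM].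
(* The bound [M] of [h] bounds [h \o g] on all of [D], while continuity of [h \o g] is available
   only at the points [X w]. *)
apply: (outer_expectation_cvg dirA mX X_X (f := h \o g) (M := M)).
- by move=> x; exact: hM.
- by move=> w; apply: continuous_comp; [exact: cg|exact: ch].
Qed.
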